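(* Let $\omega\in\mathbb{C}$ be such that $R=\mathbb{Z}[\omega]=\{a+b\omega : a,b\in\mathbb{Z}\}$ is a ring and a principal ideal domain. Let $\Lambda\subseteq\mathbb{C}^n$ be an $n$-dimensional $R$-lattice and let $\Lambda'\subseteq\Lambda$ be an $R$-sublattice of finite index $|\Lambda:\Lambda'|<\infty$. Suppose that the annihilator of the quotient $R$-module $\Lambda/\Lambda'$ is $$\mathrm{Ann}(\Lambda/\Lambda')=(p_1p_2\cdots p_s)$$ for some $s\ge 1$, where $p_1,\dots,p_s$ are distinct (pairwise non-associate) primes of $R$, all satisfying $|R:(p_i)|=q$ for one and the same finite number $q$. Then $\Lambda/\Lambda'$ is isomorphic to some vector space over the finite field $\mathbb{F}_q$; that is, there is an integer $m\ge 0$ and an isomorphism of $R$-modules $\Lambda/\Lambda'\cong\mathbb{F}_q^m$, where $R$ acts on each coordinate of $\mathbb{F}_q^m$ through some surjective ring homomorphism $R\to R/(p_i)\cong\mathbb{F}_q$ (the index $i\in\{1,\dots,s\}$ may depend on the coordinate).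
   Context: An $n$-dimensional $R$-lattice in $\mathbb{C}^n$ is a set $\Lambda=\{r_1 g_1+\cdots+r_n g_n : r_1,\dots,r_n\in R\}$, where $g_1,\dots,g_n\in\mathbb{C}^n$ are linearly independent (row) vectors; it is an $R$-module. An $R$-sublattice of $\Lambda$ is a subset of $\Lambda$ that is itself an $R$-lattice; finite index forces it to have the same dimension $n$. The set of cosets $\Lambda/\Lambda'$ (called a lattice partition) is the quotient $R$-module, and $|\Lambda:\Lambda'|$ is the number of cosets. For an $R$-module $M$, $\mathrm{Ann}(M)=\{r\in R : rm=0 \text{ for all } m\in M\}$. $|R:(p)|$ denotes the cardinality of $R/(p)$. *)

(* Defs.v *)
From HB Require Import structures.
From mathcomp Require Import all_boot all_order all_algebra.
From mathcomp Require Import boolp classical_sets functions cardinality reals.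
From mathcomp Require Import complex.

Set Implicit Arguments.
Unset Strict Implicit.
Unset Printing Implicit Defensive.

Import GRing.Theory.

Local Open Scope ring_scope.
Local Open Scope quotient_scope.

Section Ideals.
Variable R : idomainType.

Definition divides (a x : R) : Prop := exists c, x = c * a.

Definition associates (a b : R) : Prop := exists2 u, u \is a GRing.unit & b = u * a.

Definition prime_element (p : R) : Prop :=
  [/\ p != 0, p \isn't a GRing.unit &
      forall a b, divides p (a * b) -> divides p a \/ divides p b].

Definition ideal (I : {pred R}) : Prop :=
  [/\ 0 \in I, {in I &, forall x y, x + y \in I} &
      forall a, {in I, forall x, a * x \in I}].

Definition principal (a : R) : {pred R} := [pred x | `[< divides a x >]].

Definition is_PID : Prop :=
  forall I : {pred R}, ideal I -> exists a, I =i principal a.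

Fact principal_zmod_closed a : zmod_closed (principal a).
Proof.
split=> [|x y]; first by apply/asboolP; exists 0; rewrite mul0r.
by move=> /asboolP[c ->] /asboolP[d ->]; apply/asboolP; exists (c - d); rewrite mulrBl.
Qed.

HB.instance Definition _ a :=
  GRing.isZmodClosed.Build R (principal a) (principal_zmod_closed a).

Fact principalM a r x : x \in principal a -> r * x \in principal a.
Proof. by move=> /asboolP[c ->]; apply/asboolP; exists (r * c); rewrite mulrA. Qed.

End Ideals.

(* The library only gives R / I a ring structure when I is proper; here a may  *)
(* be a unit, so that R / (a) is a possibly trivial ring (a pzRingType).       *)
Section ResidueRing.
Variables (R : idomainType) (a : R).

Definition residue_ring : Type := Quotient.quot (principal a).

HB.instance Definition _ := GRing.Zmodule.on residue_ring.

Definition residue (x : R) : residue_ring := \pi_(Quotient.quot (principal a)) x.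

Definition mulq (x y : residue_ring) : residue_ring :=
  residue (repr (x : Quotient.quot (principal a)) *
           repr (y : Quotient.quot (principal a))).

Fact residue_eq x y : (residue x == residue y) = (x - y \in principal a).
Proof. by rewrite /residue -Quotient.idealrBE. Qed.

Fact residueP (x : residue_ring) : exists r, x = residue r.
Proof.
by exists (repr (x : Quotient.quot (principal a))); rewrite /residue reprK.
Qed.

Fact residue_is_zmod_morphism : zmod_morphism residue.
Proof. by move=> x y; rewrite /residue raddfB. Qed.

HB.instance Definition _ :=
  GRing.isZmodMorphism.Build R residue_ring residue residue_is_zmod_morphism.

Fact repr_residue x :
  repr (residue x : Quotient.quot (principal a)) - x \in principal a.
Proof. by rewrite -residue_eq /residue reprK. Qed.

Fact residueM x y : residue (x * y) = mulq (residue x) (residue y).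
Proof.
apply/eqP; rewrite eq_sym residue_eq.
set x' := repr _; set y' := repr _.
have -> : x' * y' - x * y = y' * (x' - x) + x * (y' - y).
  by rewrite !mulrBr addrA [y' * x']mulrC [y' * x]mulrC subrK.
by apply: rpredD; apply: principalM; apply: repr_residue.
Qed.

Fact mulqA : associative mulq.
Proof.
move=> x y z; have [[r ->] [[s ->] [t ->]]] := (residueP x, (residueP y, residueP z)).
by rewrite -!residueM mulrA.
Qed.

Fact mulqC : commutative mulq.
Proof. by move=> x y; rewrite /mulq mulrC. Qed.

Fact mul1q : left_id (residue 1) mulq.
Proof. by move=> x; have [r ->] := residueP x; rewrite -residueM mul1r. Qed.

Fact mulqDl : left_distributive mulq +%R.
Proof.
move=> x y z; have [[r ->] [[s ->] [t ->]]] := (residueP x, (residueP y, residueP z)).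
by rewrite -raddfD -!residueM -raddfD /= mulrDl.
Qed.

HB.instance Definition _ :=
  GRing.Zmodule_isComPzRing.Build residue_ring mulqA mulqC mul1q mulqDl.

Fact residue_is_monoid_morphism : monoid_morphism residue.
Proof. by split=> // x y; apply: residueM. Qed.

HB.instance Definition _ :=
  GRing.isMonoidMorphism.Build R residue_ring residue residue_is_monoid_morphism.

End ResidueRing.

Section Modules.
Variable R : idomainType.

Definition annihilator (M : lmodType R) : {pred R} :=
  [pred r | `[< forall m : M, r *: m = 0 >]].

(* F^m with R acting on the j-th coordinate through sigma j : R -> F.          *)
Definition twisted (F : fieldType) m (sigma : 'I_m -> {rmorphism R -> F}) : Type :=
  'rV[F]_m.

Section Twisted.
Variables (F : fieldType) (m : nat) (sigma : 'I_m -> {rmorphism R -> F}).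
Local Notation V := (twisted sigma).

HB.instance Definition _ := GRing.Zmodule.on V.

Definition twisted_scale (r : R) (v : V) : V := \row_j (sigma j r * (v : 'rV[F]_m) 0 j).

Fact twisted_scaleA r s v : twisted_scale r (twisted_scale s v) = twisted_scale (r * s) v.
Proof. by apply/rowP=> j; rewrite !mxE rmorphM mulrA. Qed.

Fact twisted_scale1 : left_id 1 twisted_scale.
Proof. by move=> v; apply/rowP=> j; rewrite !mxE rmorph1 mul1r. Qed.

Fact twisted_scaleDr : right_distributive twisted_scale +%R.
Proof. by move=> r u v; apply/rowP=> j; rewrite !mxE mulrDr. Qed.

Fact twisted_scaleDl v : {morph twisted_scale^~ v : r s / r + s}.
Proof. by move=> r s; apply/rowP=> j; rewrite !mxE rmorphD mulrDl. Qed.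

HB.instance Definition _ := GRing.Zmodule_isLmodule.Build R V
  twisted_scaleA twisted_scale1 twisted_scaleDr twisted_scaleDl.

End Twisted.

Section QuotientModule.
Variables (M : lmodType R) (N : submodClosed M).

Definition submod_pred : {pred M} := N.

Fact submod_pred_zmod_closed : zmod_closed submod_pred.
Proof.
split=> [|x y xN yN]; first exact: (rpred0 N).
by rewrite -scaleN1r; apply: (rpredD (S := N)) => //; apply: rpredZ.
Qed.

HB.instance Definition _ :=
  GRing.isZmodClosed.Build M submod_pred submod_pred_zmod_closed.

Definition quotient_module : Type := Quotient.quot submod_pred.

HB.instance Definition _ := GRing.Zmodule.on quotient_module.

Definition coset_of (x : M) : quotient_module := \pi_(Quotient.quot submod_pred) x.

Definition scaleq (r : R) (x : quotient_module) : quotient_module :=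
  coset_of (r *: repr (x : Quotient.quot submod_pred)).

Fact coset_of_eq x y : (coset_of x == coset_of y) = (x - y \in N).
Proof. by rewrite /coset_of -Quotient.idealrBE. Qed.

Fact coset_ofP (x : quotient_module) : exists m, x = coset_of m.
Proof. by exists (repr (x : Quotient.quot submod_pred)); rewrite /coset_of reprK. Qed.

Fact coset_of_is_zmod_morphism : zmod_morphism coset_of.
Proof. by move=> x y; rewrite /coset_of raddfB. Qed.

HB.instance Definition _ :=
  GRing.isZmodMorphism.Build M quotient_module coset_of coset_of_is_zmod_morphism.

Fact coset_ofZ r x : coset_of (r *: x) = scaleq r (coset_of x).
Proof.
apply/eqP; rewrite eq_sym coset_of_eq -scalerBr.
by apply: rpredZ; rewrite -coset_of_eq /coset_of reprK.
Qed.

Fact scaleqA r s x : scaleq r (scaleq s x) = scaleq (r * s) x.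
Proof. by have [m ->] := coset_ofP x; rewrite -!coset_ofZ scalerA. Qed.

Fact scaleq1 : left_id 1 scaleq.
Proof. by move=> x; have [m ->] := coset_ofP x; rewrite -coset_ofZ scale1r. Qed.

Fact scaleqDr : right_distributive scaleq +%R.
Proof.
move=> r x y; have [[m ->] [n ->]] := (coset_ofP x, coset_ofP y).
by rewrite -raddfD -!coset_ofZ -raddfD scalerDr.
Qed.

Fact scaleqDl x : {morph scaleq^~ x : r s / r + s}.
Proof.
by move=> r s; have [m ->] := coset_ofP x; rewrite -!coset_ofZ -raddfD scalerDl.
Qed.

HB.instance Definition _ := GRing.Zmodule_isLmodule.Build R quotient_module
  scaleqA scaleq1 scaleqDr scaleqDl.

Fact coset_of_is_scalable : scalable coset_of.
Proof. exact: coset_ofZ. Qed.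

HB.instance Definition _ :=
  GRing.isScalable.Build R M quotient_module _ coset_of coset_of_is_scalable.

End QuotientModule.
End Modules.

(* {a + b omega : a, b integers}; not a ring for every omega.                  *)
Definition Zomega (C : fieldType) (omega : C) : {pred C} :=
  [pred x | `[< exists a b : int, x = a%:~R + b%:~R * omega >]].

(* Z[omega] as a type, for omega such that Zomega omega is a subring of C.     *)
Section ZomegaRing.
Variables (C : fieldType) (omega : C).

Definition Zring_pred (_ : subring_closed (Zomega omega)) : {pred C} := Zomega omega.

Variable hR : subring_closed (Zomega omega).

HB.instance Definition _ := GRing.isSubringClosed.Build C (Zring_pred hR) hR.

Record Zring : Type := ZringElt { Zring_val : C; _ : Zring_val \in Zring_pred hR }.

HB.instance Definition _ := [isSub for Zring_val].
HB.instance Definition _ := [Choice of Zring by <:].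
HB.instance Definition _ := [SubChoice_isSubComNzRing of Zring by <:].

Definition Zunit : {pred Zring} :=
  [pred x | (val x != 0) && ((val x)^-1 \in Zring_pred hR)].

Definition Zinv (x : Zring) : Zring := insubd x (val x)^-1.

Fact ZmulVx : {in Zunit, left_inverse 1 Zinv *%R}.
Proof.
move=> x /andP[x0 xR]; apply: val_inj.
by rewrite rmorphM rmorph1 /= [Zring_val (Zinv x)]insubdK // mulVf.
Qed.

Fact Zunit_intro x y : y * x = 1 -> Zunit x.
Proof.
move=> /(congr1 val); rewrite rmorphM rmorph1 /= => yx.
have x0 : Zring_val x != 0.
  by apply: contra_eq_neq yx => ->; rewrite mulr0 eq_sym oner_neq0.
rewrite /Zunit /= x0 /=; have -> : (Zring_val x)^-1 = Zring_val y; last exact: valP.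
by apply: (mulIf x0); rewrite mulVf.
Qed.

Fact Zinv_out : {in [predC Zunit], Zinv =1 id}.
Proof.
move=> x; rewrite inE /= negb_and negbK; case/orP=> [/eqP x0|xR].
  by apply: val_inj; rewrite val_insubd x0 invr0 if_same.
by apply: val_inj; rewrite val_insubd (negPf xR).
Qed.

HB.instance Definition _ :=
  GRing.ComNzRing_hasMulInverse.Build Zring ZmulVx Zunit_intro Zinv_out.

Fact Zring_integral (x y : Zring) : x * y = 0 -> (x == 0) || (y == 0).
Proof.
move=> /(congr1 val)/eqP; rewrite rmorphM rmorph0 /= mulf_eq0.
by rewrite -!(inj_eq val_inj) rmorph0.
Qed.

HB.instance Definition _ := GRing.ComUnitRing_isIntegral.Build Zring Zring_integral.

End ZomegaRing.

Section Lattices.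
Variables (C : fieldType) (omega : C) (hR : subring_closed (Zomega omega)).
Local Notation R := (Zring hR).

(* R acts on C^n by restriction of scalars along val : R -> C.                 *)
(* This is the R-span of the rows of G; it is an R-lattice when row_free G.     *)
Definition lattice k n (G : 'M[C]_(k, n)) : {pred 'rV[C]_n} :=
  [pred v | `[< exists r : 'I_k -> R, v = \sum_i val (r i) *: row i G >]].

Section LatticeModule.
Variables (k n : nat) (G : 'M[C]_(k, n)).

Fact lattice_zmod_closed : zmod_closed (lattice G).
Proof.
split=> [|x y].
  apply/asboolP; exists (fun=> 0); rewrite big1 // => i _.
  by rewrite rmorph0 scale0r.
move=> /asboolP[r ->] /asboolP[s ->]; apply/asboolP; exists (fun i => r i - s i).
by rewrite -sumrB; apply: eq_bigr => i _; rewrite rmorphB scalerBl.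
Qed.

HB.instance Definition _ := GRing.isZmodClosed.Build _ (lattice G) lattice_zmod_closed.

Fact latticeZ (a : R) v : v \in lattice G -> val a *: v \in lattice G.
Proof.
move=> /asboolP[r ->]; apply/asboolP; exists (fun i => a * r i).
by rewrite scaler_sumr; apply: eq_bigr => i _; rewrite rmorphM scalerA.
Qed.

Record lattice_type : Type :=
  LatticeElt { lattice_val : 'rV[C]_n; _ : lattice_val \in lattice G }.

HB.instance Definition _ := [isSub for lattice_val].
HB.instance Definition _ := [Choice of lattice_type by <:].
HB.instance Definition _ := [SubChoice_isSubZmodule of lattice_type by <:].

Definition scalel (a : R) (x : lattice_type) : lattice_type :=
  LatticeElt (latticeZ a (valP x)).

Fact scalelA a b x : scalel a (scalel b x) = scalel (a * b) x.
Proof. by apply: val_inj; rewrite /= scalerA. Qed.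

Fact scalel1 : left_id 1 scalel.
Proof. by move=> x; apply: val_inj; rewrite /= scale1r. Qed.

Fact scalelDr : right_distributive scalel +%R.
Proof. by move=> a x y; apply: val_inj; rewrite /= scalerDr. Qed.

Fact scalelDl x : {morph scalel^~ x : a b / a + b}.
Proof. by move=> a b; apply: val_inj; rewrite /= scalerDl. Qed.

HB.instance Definition _ := GRing.Zmodule_isLmodule.Build R lattice_type
  scalelA scalel1 scalelDr scalelDl.

End LatticeModule.

Section LatticePartition.
Variables (k l n : nat) (G : 'M[C]_(k, n)) (G' : 'M[C]_(l, n)).

(* When lattice G' is contained in lattice G, sublattice is lattice G' viewed  *)
(* inside the R-module lattice_type G, and lattice_partition is the R-module   *)
(* of cosets lattice G / lattice G'.                                           *)
Definition sublattice : {pred lattice_type G} := [pred x | val x \in lattice G'].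

Fact in_sublattice x : (x \in sublattice) = (val x \in lattice G').
Proof. by []. Qed.

Fact sublattice_submod_closed : submod_closed sublattice.
Proof.
split=> [|a x y]; first by rewrite in_sublattice raddf0 rpred0.
rewrite !in_sublattice raddfD => xG yG.
by apply: rpredD => //; apply: latticeZ.
Qed.

HB.instance Definition _ :=
  GRing.isSubmodClosed.Build R (lattice_type G) sublattice sublattice_submod_closed.

Definition lattice_partition : Type := quotient_module sublattice.

HB.instance Definition _ := GRing.Lmodule.on lattice_partition.

End LatticePartition.
End Lattices.

(* Main.v *)
From mathcomp Require Import fingroup cyclic finfield.
Require Import Defs.
From HB Require Import structures.
From mathcomp Require Import all_boot all_order all_algebra.
From mathcomp Require Import boolp classical_sets functions cardinality reals.
From mathcomp Require Import complex.

Set Implicit Arguments.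
Unset Strict Implicit.
Unset Printing Implicit Defensive.

Import GRing.Theory.

Local Open Scope ring_scope.

(* Let M be the quotient module; it is finite and killed by p_1 ... p_s. Take  *)
(* a family of elements b_j of M, each killed by one of the primes p_(idx j),  *)
(* such that a relation \sum_j r_j b_j = 0 forces p_(idx j) | r_j for all j.   *)
(* If its span N misses some y, then {r | r y \in N} = (d) with d a nonunit    *)
(* dividing p_1 ... p_s, so that some p_i divides d; then z = (\prod_(l != i)  *)
(* p_l) y is killed by p_i and is not in N, because p_i does not divide any    *)
(* other p_l, and z can be added to the family. As M is finite, this process   *)
(* stops at a spanning family, for which the coordinates r_j modulo p_(idx j)  *)
(* are well defined and give the isomorphism. The residue fields are then      *)
(* identified with one another, being finite of the same cardinality.          *)

(** As the annihilator is generated by a product of distinct primes, the quotient is a direct sum of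
    simple modules R/(p_i). No splitting into primary components is used: [prime_torsion_outside]
    finds a new generator outside any proper submodule, [torsion_basis_extend] shows that the sum
    stays direct, and [finite_torsion_decomposition] reads off coordinates. [finField_isom] moves
    all of them into one field F. *)

Lemma finField_primitive (K : finFieldType) :
  exists a : K, forall x, x != 0 -> exists n, x = a ^+ n.
Proof.
have /cyclicP[u defU] := field_unit_group_cyclic [set: {unit K}].
exists (val u) => x x0.
have /cycleP[n eqn] : finField_unit x0 \in <[u]>%g by rewrite -defU inE.
by exists n; rewrite -FinRing.val_unitX -eqn.
Qed.

(** X^|F| - X is the product of all X - c with c in F, so f is, up to a scalar, the product over a
    sublist, nonempty because f is not constant. *)
Lemma root_of_dvdp_genPoly (F : finFieldType) (f : {poly F}) :
  (1 < size f)%N -> f %| 'X^#|F| - 'X -> exists b, root f b.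
Proof.
rewrite finField_genPoly => f_gt1 /dvdp_prod_XsubC[msk eq_f].
set s := mask _ _ in eq_f; case: s eq_f => [|b s] eq_f.
  by rewrite (eqp_size eq_f) big_nil size_poly1 in f_gt1.
by exists b; rewrite (eqp_root eq_f) root_prod_XsubC mem_head.
Qed.

(** The polynomials vanishing at a form an ideal, nonzero thanks to [P0]; f is a nonzero member of
    least size, and division with remainder shows that it generates. *)
Lemma horner_morphism_kernel (k K : fieldType) (i : {rmorphism k -> K}) (a : K)
    (P0 : {poly k}) :
  P0 != 0 -> root (map_poly i P0) a ->
  exists2 f, f != 0 & forall P, root (map_poly i P) a = (f %| P).
Proof.
move=> P0n0 rP0.
pose has_size n := `[< exists P, [/\ P != 0, root (map_poly i P) a & size P = n] >].
have ex_size : exists n, has_size n by exists (size P0); apply/asboolP; exists P0.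
case: (ex_minnP ex_size) => _ /asboolP[f [fn0 /eqP rf <-]] f_min; exists f => // P.
apply/idP/idP => [rP|/dvdpP[u ->]]; last first.
  by rewrite rootE rmorphM hornerM rf mulr0.
apply: contraT => fNP; have := f_min (size (P %% f)).
rewrite leqNgt ltn_modp fn0 => /(_ _)/negP[]//; apply/asboolP; exists (P %% f).
split=> //; rewrite rootE.
have := rP; rewrite rootE {1}(divp_eq P f) rmorphD rmorphM hornerD hornerM rf.
by rewrite mulr0 add0r.
Qed.

(* Both fields contain 'F_p; a generator of K^* is sent to a root, in F, of its *)
(* minimal polynomial over 'F_p, which divides X^|F| - X.                       *)
Lemma finField_isom (K F : finFieldType) :
  #|K| = #|F| -> exists f : {rmorphism K -> F}, bijective f.
Proof.
move=> eqKF; have [p pr_p charK] := finPcharP K.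
have charF : p \in [pchar F].
  apply: (@card_finPcharP _ _ (logn p #|K|)) => //; rewrite -eqKF.
  exact: (card_pprimeChar charK).
have iK : {rmorphism 'F_p -> K} 
  by exact: (GRing.in_alg (pPrimeCharType charK) :
               {rmorphism 'F_p -> pPrimeCharType charK}).
have iF : {rmorphism 'F_p -> F} 
  by exact: (GRing.in_alg (pPrimeCharType charF) :
               {rmorphism 'F_p -> pPrimeCharType charF}).
have [a genK] := finField_primitive K.
pose P0 : {poly 'F_p} := 'X^#|F| - 'X.
have sP0 : size P0 = #|F|.+1.
  by rewrite size_polyDl ?size_polyXn // size_polyN size_polyX ltnS finNzRing_gt1.
have rP0 : root (map_poly iK P0) a.
  rewrite rootE rmorphB /= map_polyXn map_polyX !hornerE -eqKF.
  by rewrite expf_card subrr.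
have [|f fn0 kerK] := horner_morphism_kernel _ rP0.
  by rewrite -size_poly_eq0 sP0.
(* f is not constant, since a nonzero constant does not vanish at a; and f divides [P0], which
   vanishes at a. *)
have [b rb] : exists b, root (map_poly iF f) b.
  apply: root_of_dvdp_genPoly.
    rewrite size_map_poly ltn_neqAle eq_sym lt0n size_poly_eq0 fn0 andbT.
    apply/negP => /size_poly1P[c cn0 f_c].
    have := dvdpp f; rewrite -kerK f_c map_polyC rootC fmorph_eq0.
    by rewrite (negPf cn0).
  have -> : 'X^#|F| - 'X = map_poly iF P0 by rewrite rmorphB /= map_polyXn map_polyX.
  by rewrite dvdp_map -kerK.
(* The value at b depends only on the value at a, as f divides P - Q. Hence the map P(a) |-> P(b) is
   well defined and multiplicative. *)
have ev_eq P Q : (map_poly iK P).[a] = (map_poly iK Q).[a] ->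
    (map_poly iF P).[b] = (map_poly iF Q).[b].
  move=> /eqP; rewrite -subr_eq0 -hornerN -hornerD -rmorphB -rootE kerK.
  move=> /dvdpP[u /eqP]; rewrite subr_eq => /eqP ->.
  by rewrite rmorphD rmorphM hornerD hornerM (eqP rb) mulr0 add0r.
have /choice[P evP] : forall x, exists P, (map_poly iK P).[a] = x.
  move=> x; have [->|/genK[n ->]] := eqVneq x 0; first by exists 0; rewrite rmorph0 horner0.
  by exists 'X^n; rewrite map_polyXn hornerXn.
pose g x := (map_poly iF (P x)).[b].
have gB : zmod_morphism g.
  move=> x y; rewrite /g -hornerN -hornerD -rmorphB; apply: ev_eq.
  by rewrite rmorphB hornerD hornerN !evP.
have gM : monoid_morphism g.
  split=> [|x y]; rewrite /g.
    have -> : 1 = (map_poly iF 1).[b] by rewrite rmorph1 hornerC.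
    by apply: ev_eq; rewrite evP rmorph1 hornerC.
  by rewrite -hornerM -rmorphM; apply: ev_eq; rewrite rmorphM hornerM !evP.
pose gA := GRing.isZmodMorphism.Build K F g gB.
pose gMm := GRing.isMonoidMorphism.Build K F g gM.
pose h : {rmorphism K -> F} := HB.pack g gA gMm.
exists h; apply: inj_card_bij; first exact: fmorph_inj.
by rewrite eqKF.
Qed.

(** * The residue ring of a prime, when finite, is a finite field *)

Section ResidueField.
Variables (R : idomainType) (a : R).

(** The two proofs are arguments so that the field and finiteness instances, which depend on them,
    can be attached to this alias. *)
Definition residue_field of prime_element a & finite_set [set: residue_ring a] : Type :=
  residue_ring a.

Variables (ha : prime_element a) (hfin : finite_set [set: residue_ring a]).
Local Notation K := (residue_field ha hfin).

HB.instance Definition _ := GRing.ComPzRing.on K.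

Lemma residue_eq0 x : (residue a x == 0) = (x \in principal a).
Proof. by rewrite -(raddf0 (residue a)) residue_eq subr0. Qed.

Fact residue_field_nontrivial : 1 != 0 :> K.
Proof.
have [a0 aU _] := ha.
change (residue a 1 != 0); rewrite residue_eq0; apply: contra aU => /asboolP[c ca].
by apply/unitrPr; exists c; rewrite mulrC.
Qed.

HB.instance Definition _ := GRing.PzSemiRing_isNonZero.Build K residue_field_nontrivial.

Fact residue_field_mulf_eq0 (x y : K) : x * y = 0 -> (x == 0) || (y == 0).
Proof.
have [_ _ pr] := ha.
have [[r ->] [s ->]] := (residueP x, residueP y).
change (residue a r * residue a s = 0 -> (residue a r == 0) || (residue a s == 0)).
rewrite -rmorphM => /eqP; rewrite !residue_eq0 => /asboolP/pr[] d; apply/orP.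
  by left; apply/asboolP.
by right; apply/asboolP.
Qed.

Fact residue_field_enum_subproof : exists e : seq K, Finite.axiom e.
Proof.
have /finite_seqP[e eE] := hfin; exists (undup e : seq K) => x.
rewrite count_uniq_mem ?undup_uniq // mem_undup.
by have -> : x \in e by have : [set: residue_ring a]%classic x by []; rewrite eE.
Qed.

(** The instances need an actual enumeration, so one is picked by classical choice. *)
Let enum_field := xget [::] [set e : seq K | Finite.axiom e]%classic.

Let enum_fieldP : Finite.axiom enum_field.
Proof. exact: (xgetPex _ residue_field_enum_subproof). Qed.

Let mem_enum_field (x : K) : x \in enum_field.
Proof. by rewrite -has_pred1 has_count enum_fieldP. Qed.

Fact residue_field_pickleK :
  pcancel (index^~ enum_field) (nth None [seq Some x | x <- enum_field]).
Proof.
move=> x; rewrite (nth_map x) ?index_mem ?mem_enum_field //.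
by rewrite nth_index ?mem_enum_field.
Qed.

HB.instance Definition _ := Choice_isCountable.Build K residue_field_pickleK.
HB.instance Definition _ := isFinite.Build K enum_fieldP.

(** Multiplication by a nonzero x is injective on a finite domain, hence bijective, and 1 is
    attained. *)
Fact residue_field_inverse (x : K) : exists y : K, x != 0 -> y * x = 1.
Proof.
have [->|x0] := eqVneq x 0; first by exists 0.
have mulxI : injective (fun y : K => y * x).
  move=> y z /eqP; rewrite -subr_eq0 -mulrBl => /eqP/residue_field_mulf_eq0.
  by rewrite (negPf x0) orbF subr_eq0 => /eqP.
by have [g _ gK] := injF_bij mulxI; exists (g 1); rewrite gK.
Qed.

Let inv_field (x : K) : K :=
  if x == 0 then 0 else xget 0 [set y | x != 0 -> y * x = 1]%classic.

Let mulVf_field (x : K) : x != 0 -> inv_field x * x = 1.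
Proof.
move=> x0; rewrite /inv_field ifN //.
exact: (@xgetPex _ 0 [set y | x != 0 -> y * x = 1]%classic (residue_field_inverse x) x0).
Qed.

Let invr0_field : inv_field 0 = 0. Proof. by rewrite /inv_field eqxx. Qed.

HB.instance Definition _ := GRing.ComNzRing_isField.Build K mulVf_field invr0_field.

Lemma card_residue_field q : ([set: residue_ring a] #= `I_q)%card -> #|{: K}| = q.
Proof.
move=> eq_q; apply/card_eq_II.
have cardK : (`I_#|{: K}| #= [set: K])%card.
  apply/card_esym/card_set_bijP; exists (fun x => enum_rank x : nat).
  split=> [x _|x y _ _ /val_inj/enum_rank_inj //|i i_lt]; first exact: ltn_ord.
  by exists (enum_val (Ordinal i_lt)) => //; rewrite enum_valK.
exact: card_eq_trans cardK eq_q.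
Qed.
End ResidueField.

(** * Divisibility and products of primes *)

Lemma divides_trans (R : idomainType) (a b c : R) :
  divides a b -> divides b c -> divides a c.
Proof. by move=> [u ->] [v ->]; exists (v * u); rewrite mulrA. Qed.

Section PrimeProducts.
Variable R : idomainType.

Lemma prime_divides_prod (I : Type) (r : seq I) (P : pred I) (p : I -> R) (a : R) :
  prime_element a -> divides a (\prod_(i <- r | P i) p i) ->
  exists2 i, P i & divides a (p i).
Proof.
move=> [_ aU pr]; elim/big_rec: _ => [[c ca]|i x Pi IH].
  by case/negP: aU; apply/unitrPr; exists c; rewrite mulrC -ca.
by move=> /pr[ai|/IH//]; exists i.
Qed.

(** Write b = c a. The prime b divides c or a: the first would make a a unit, the second makes c
    one. *)
Lemma prime_divides_associates (a b : R) :
  prime_element a -> prime_element b -> divides a b -> associates a b.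
Proof.
move=> [a0 aU _] [b0 bU prb] [c eq_b]; exists c => //.
have [] : divides b c \/ divides b a.
- by apply: prb; exists 1; rewrite -eq_b mul1r.
- move=> [d eq_c]; case/negP: aU; apply/unitrPr; exists d.
  apply: (mulfI b0); rewrite mulr1 [RHS]eq_b eq_c.
  by rewrite [d * b]mulrC mulrAC mulrA.
move=> [d eq_a]; apply/unitrPr; exists d.
by apply: (mulIf b0); rewrite mul1r {2}eq_b eq_a mulrA.
Qed.

(** If c d = p_i x, then p_i divides d, or it divides c and can be cancelled, so that d divides the
    shorter product x. *)
Lemma nonunit_divides_prod (I : Type) (r : seq I) (p : I -> R) (d : R) :
  (forall i, prime_element (p i)) -> d \isn't a GRing.unit ->
  divides d (\prod_(i <- r) p i) -> exists i, divides (p i) d.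
Proof.
move=> hp dU; elim/big_rec: _ => [[c cd]|i x _ IH].
  by case/negP: dU; apply/unitrPr; exists c; rewrite mulrC -cd.
have [p0 _ pr] := hp i; move=> [c eq_c].
have [[u eq_u]|] : divides (p i) c \/ divides (p i) d; last by exists i.
  by apply: pr; exists x; rewrite -eq_c mulrC.
apply: IH; exists u; apply: (mulfI p0); rewrite eq_c eq_u.
by rewrite [u * _]mulrC mulrA.
Qed.

End PrimeProducts.

(** * Decomposition of a finite module killed by a product of distinct primes *)

Section Decomposition.
Variables (R : idomainType) (hPID : is_PID R) (M : lmodType R).
Variables (s : nat) (p : 'I_s -> R).
Hypothesis p_prime : forall i, prime_element (p i).
Hypothesis p_distinct : forall i j, i != j -> ~ associates (p i) (p j).
Hypothesis p_kill : forall x : M, (\prod_i p i) *: x = 0.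

(** This is where principality of ideals and distinctness of the primes enter. *)
Lemma prime_torsion_outside (N : {pred M}) (y : M) :
  submod_closed N -> y \notin N ->
  exists i z, p i *: z = 0 /\ z \notin N.
Proof.
move=> [N0 NL] yN.
pose I : {pred R} := [pred r | r *: y \in N].
have idealI : ideal I.
  split=> [|a b|a b]; rewrite !inE.
  - by rewrite scale0r.
  - by move=> aI bI; rewrite scalerDl -[a *: y]scale1r; apply: NL.
  - by move=> bI; rewrite -scalerA -[_ *: _]addr0; apply: NL.
have [d Id] := hPID idealI.
have divI r : divides d r <-> r *: y \in N.
  have -> : (r *: y \in N) = (r \in principal d) by rewrite -Id.
  by split=> [dr|/asboolP//]; apply/asboolP.
have dU : d \isn't a GRing.unit.
  apply: contra yN => dU; rewrite -[y]scale1r; apply/divI.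
  by exists d^-1; rewrite mulVr.
have [i pd] : exists i, divides (p i) d.
  by apply: (@nonunit_divides_prod _ _ (index_enum 'I_s) p d) => //; apply/divI; rewrite p_kill.
exists i, ((\prod_(j | j != i) p j) *: y); split.
  by rewrite scalerA; have := p_kill y; rewrite (bigD1 i).
apply/negP => /divI/(divides_trans pd)/prime_divides_prod[|j ji pij] //.
apply: (p_distinct (i := i) (j := j)); first by rewrite eq_sym.
exact: prime_divides_associates.
Qed.

Variables (F : fieldType) (sigma : 'I_s -> {rmorphism R -> F}).
Hypothesis sigma_surj : forall i c, exists r, sigma i r = c.
Hypothesis sigma_ker : forall i r, sigma i r = 0 <-> divides (p i) r.

(** The span of b is then the direct sum of the R b_j, each a copy of R/(p_(idx j)); divisibility by
    the prime is expressed as vanishing under [sigma]. *)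
Definition torsion_basis m (idx : 'I_m -> 'I_s) (b : 'I_m -> M) : Prop :=
  (forall j, p (idx j) *: b j = 0) /\
  (forall r : 'I_m -> R, \sum_j r j *: b j = 0 -> forall j, sigma (idx j) (r j) = 0).

Definition spans m (b : 'I_m -> M) : Prop :=
  forall y, exists r : 'I_m -> R, y = \sum_j r j *: b j.

(** On elements killed by p_i, the action of R factors through the residue field. *)
Lemma sigma_scale i (z : M) r r' :
  p i *: z = 0 -> sigma i r = sigma i r' -> r *: z = r' *: z.
Proof.
move=> pz /eqP; rewrite -subr_eq0 -rmorphB => /eqP/sigma_ker[c eq_c].
by apply/eqP; rewrite -subr_eq0 -scalerBl eq_c -scalerA pz scaler0.
Qed.

Lemma torsion_basis_extend m (idx : 'I_m -> 'I_s) (b : 'I_m -> M) :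
  torsion_basis idx b -> ~ spans b ->
  exists (idx' : 'I_m.+1 -> 'I_s) b', torsion_basis idx' b'.
Proof.
move=> [b_tors b_free] /existsNP[y yNspan].
pose N : {pred M} := [pred y | `[< exists r : 'I_m -> R, y = \sum_j r j *: b j >]].
have NL : submod_closed N.
  split=> [|a u v /asboolP[r ->] /asboolP[t ->]]; apply/asboolP.
    by exists (fun=> 0); rewrite big1 // => j _; rewrite scale0r.
  exists (fun j => a * r j + t j); rewrite scaler_sumr -big_split /=.
  by apply: eq_bigr => j _; rewrite scalerDl scalerA.
have [i [z [pz zN]]] : exists i z, p i *: z = 0 /\ z \notin N.
  by apply: (prime_torsion_outside NL (y := y)); apply/negP => /asboolP/yNspan.
exists (fun j => if unlift ord0 j is Some j' then idx j' else i).
exists (fun j => if unlift ord0 j is Some j' then b j' else z).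
split=> [j|r]; first by case: unliftP.
rewrite big_ord_recl unlift_none.
under eq_bigr do rewrite liftK.
move=> rel.
(* Otherwise the coefficient of z is invertible modulo p_i; with t lifting its inverse, z = t r_0 z,
   and the relation puts z in N. *)
have sr0 : sigma i (r ord0) = 0.
  apply/eqP; apply: contraNT zN => sr0.
  have [t eq_t] := sigma_surj i (sigma i (r ord0))^-1.
  have -> : z = t *: (r ord0 *: z).
    rewrite scalerA -[LHS]scale1r; apply: (sigma_scale pz).
    by rewrite rmorph1 rmorphM eq_t mulVf.
  move/eqP: rel; rewrite addr_eq0 => /eqP ->.
  apply/asboolP; exists (fun j => - t * r (lift ord0 j)).
  by rewrite -sumrN scaler_sumr; apply: eq_bigr => j _; rewrite scalerN scalerA mulNr scaleNr.
move: rel; rewrite (sigma_scale (r' := 0) pz); last by rewrite sr0 rmorph0.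
rewrite scale0r add0r => /b_free bf j.
by case: unliftP => [j' ->|->].
Qed.

(** If b_i = b_j with i != j, the relation b_i - b_j = 0 has coefficient 1 at i, which [sigma] does
    not kill. This bounds the length of a family by the size of M. *)
Lemma torsion_basis_inj m (idx : 'I_m -> 'I_s) (b : 'I_m -> M) :
  torsion_basis idx b -> injective b.
Proof.
move=> [_ b_free] i j eq_b; apply/eqP; apply: contraT => ij.
have := b_free (fun k => (k == i)%:R - (k == j)%:R).
have -> : \sum_k ((k == i)%:R - (k == j)%:R) *: b k = 0.
  have sumE l : \sum_k (k == l)%:R *: b k = b l.
    rewrite (bigD1 l) //= eqxx scale1r big1 ?addr0 // => k /negPf ->.
    by rewrite scale0r.
  by under eq_bigr do rewrite scalerBl; rewrite sumrB !sumE eq_b subrr.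
by move=> /(_ erefl i)/eqP; rewrite eqxx (negPf ij) subr0 rmorph1 oner_eq0.
Qed.

Lemma torsion_basis_exists : finite_set [set: M] ->
  exists m (idx : 'I_m -> 'I_s) b, torsion_basis idx b /\ spans b.
Proof.
move=> /finite_seqP[e eE]; apply: contrapT => noB.
(* If no family spans, the empty one can be extended indefinitely, in particular to one more element
   than M has room for. *)
have [idx [b /torsion_basis_inj b_inj]] : exists (idx : 'I_(size e).+1 -> 'I_s) b, torsion_basis idx b.
  elim: (size e).+1 => [|m [idx [b bB]]].
    have f0 T : 'I_0 -> T by case.
    by exists (f0 _), (f0 _); split=> [[]|r _ []].
  by apply: (torsion_basis_extend bB) => b_span; apply: noB; exists m, idx, b.
have : (size [seq b j | j <- enum 'I_(size e).+1] <= size e)%N.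
  apply: uniq_leq_size; first by rewrite map_inj_uniq ?enum_uniq.
  by move=> x _; have : [set: M]%classic x by []; rewrite eE.
by rewrite size_map size_enum_ord ltnn.
Qed.

Lemma finite_torsion_decomposition : finite_set [set: M] ->
  exists m (idx : 'I_m -> 'I_s) (f : {linear M -> twisted (fun j => sigma (idx j))}),
    bijective f.
Proof.
move=> /torsion_basis_exists[m [idx [b [[b_tors b_free] /choice[r rE]]]]].
exists m, idx; pose V := twisted (fun j => sigma (idx j)).
(* The coefficients r are arbitrary choices, but freeness makes their residues independent of the
   choice; linearity of f follows. *)
have r_uniq y t : y = \sum_j t j *: b j -> forall j, sigma (idx j) (r y j) = sigma (idx j) (t j).
  move=> eq_y j; apply/eqP; rewrite -subr_eq0 -rmorphB; apply/eqP.
  apply: (b_free (fun j => r y j - t j)).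
  by under eq_bigr do rewrite scalerBl; rewrite sumrB -rE -eq_y subrr.
pose f (y : M) : V := \row_j sigma (idx j) (r y j).
have fL : linear f.
  move=> a u v; apply/rowP => j.
  rewrite !mxE (r_uniq _ (fun j => a * r u j + r v j)) ?rmorphD ?rmorphM //.
  under eq_bigr do rewrite scalerDl -scalerA.
  by rewrite big_split -scaler_sumr -!rE.
pose fA := GRing.isLinear.Build R M V _ f fL.
pose g : {linear M -> V} := HB.pack f fA.
exists g; have /choice[t tE] : forall i, exists t : F -> R, forall c, sigma i (t c) = c.
  by move=> i; have [t tE] := choice (sigma_surj i); exists t.
(* The inverse lifts each coordinate to R by a section of [sigma] and recombines the b_j. *)
exists (fun v : V => \sum_j t (idx j) ((v : 'rV_m) 0 j) *: b j) => [y|v] /=.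
  rewrite [RHS]rE; apply: eq_bigr => j _.
  by apply: sigma_scale => //; rewrite tE mxE.
by apply/rowP => j; rewrite mxE (r_uniq _ _ erefl) tE.
Qed.

End Decomposition.

(** * Application to lattice partitions *)

Theorem theorem2 (Re : realType) (omega : Re[i])
    (hR : subring_closed (Zomega omega)) (hPID : is_PID (Zring hR))
    (n k : nat) (G : 'M[Re[i]]_(n, n)) (G' : 'M[Re[i]]_(k, n))
    (hG : row_free G) (hG' : row_free G')
    (hsub : {subset lattice hR G' <= lattice hR G})
    (hfin : finite_set [set: lattice_partition hR G G'])
    (s : nat) (hs : (0 < s)%N) (p : 'I_s -> Zring hR)
    (hprime : forall i, prime_element (p i))
    (hdistinct : forall i j, i != j -> ~ associates (p i) (p j))
    (q : nat) (hq : forall i, ([set: residue_ring (p i)] #= `I_q)%card)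
    (hAnn : annihilator (lattice_partition hR G G') =i principal (\prod_(i < s) p i)) :
  exists F : finFieldType, #|F| = q /\
    exists (m : nat) (idx : 'I_m -> 'I_s)
           (tau : forall j : 'I_m, {rmorphism residue_ring (p (idx j)) -> F}),
      (forall j, bijective (tau j)) /\
      exists f : {linear lattice_partition hR G G' ->
                    twisted (fun j => tau j \o residue (p (idx j)))},
        bijective f.
Proof.
have p_fin i : finite_set [set: residue_ring (p i)] by apply/finite_setP; exists q.
pose K i : finFieldType := residue_field (hprime i) (p_fin i).
have card_K i : #|K i| = q by apply: card_residue_field.
(* The residue field of the first prime serves as the common field of q elements. *)
pose F := K (Ordinal hs).
have isom_K i : exists t : {rmorphism K i -> F}, bijective t.
  by apply: finField_isom; rewrite !card_K.
(* [K i] unfolds to [residue_ring (p i)], so the field isomorphism is also a morphism from the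
   residue ring. *)
pose tau i : {rmorphism residue_ring (p i) -> F} := projT1 (cid (isom_K i)).
have tau_bij i : bijective (tau i) by rewrite /tau; case: cid.
pose sigma i : {rmorphism Zring hR -> F} := tau i \o residue (p i).
have sigma_surj i c : exists r, sigma i r = c.
  have [t _ tK] := tau_bij i; have [r tc] := residueP (t c : residue_ring (p i)).
  by exists r; rewrite /sigma /= -tc tK.
have sigma_ker i r : sigma i r = 0 <-> divides (p i) r.
  have -> : sigma i r = 0 <-> residue (p i) r = 0.
    rewrite /sigma /= -(rmorph0 (tau i)); split=> [/(bij_inj (tau_bij i))//|->//].
  by split=> [/eqP|pr]; last apply/eqP; rewrite residue_eq0; [move/asboolP|apply/asboolP].
have p_kill (x : lattice_partition hR G G') : (\prod_i p i) *: x = 0.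
  have : \prod_i p i \in annihilator (lattice_partition hR G G').
    by rewrite hAnn; apply/asboolP; exists 1; rewrite mul1r.
  by move=> /asboolP.
have [m [idx [f f_bij]]] :=
  finite_torsion_decomposition hPID hprime hdistinct p_kill sigma_surj sigma_ker hfin.
exists F; split; first exact: card_K.
by exists m, idx, (fun j => tau (idx j)); split=> //; exists f.
Qed.
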